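(* Let $n\geq 2$. Up to equivalence, there is exactly one faithful effective transitive representation of $\mathcal{IP}_n$, and it is a representation in $\mathcal{IS}_{2^n-2}$ (that is, by partial bijections of a set with $2^n-2$ elements). In particular, $\mathcal{IP}_n$ embeds isomorphically into $\mathcal{IS}_{2^n-2}$.
   Context: Let $X$ be an arbitrary set and let $X'=\{x':x\in X\}$ be a disjoint copy of $X$, with $x\mapsto x'$ a fixed bijection $X\to X'$; the inverse bijection is also denoted by $'$. Let $\mathcal{CS}_X$ be the set of all partitions of $X\cup X'$ into nonempty blocks. For $a\in\mathcal{CS}_X$ write $x\equiv_a y$ if $x,y\in X\cup X'$ lie in the same block of $a$. The product $ab$ of $a,b\in\mathcal{CS}_X$ is the partition corresponding to the equivalence relation $\equiv$ on $X\cup X'$ defined, for $x,y\in X$, by: (i) $x\equiv y$ iff $x\equiv_a y$ or there are $s\ge 1$ and $c_1,\dots,c_{2s}\in X$ with $x\equiv_a c_1'$, $c_1\equiv_b c_2$, $c_2'\equiv_a c_3'$, $\dots$, $c_{2s-1}\equiv_b c_{2s}$, $c_{2s}'\equiv_a y$; (ii) $x'\equiv y'$ iff $x'\equiv_b y'$ or there are $s\ge 1$ and $c_1,\dots,c_{2s}\in X$ with $x'\equiv_b c_1$, $c_1'\equiv_a c_2'$, $c_2\equiv_b c_3$, $\dots$, $c_{2s-1}'\equiv_a c_{2s}'$, $c_{2s}\equiv_b y'$; (iii) $x\equiv y'$ iff $y'\equiv x$ iff there are $s\ge 1$ and $c_1,\dots,c_{2s-1}\in X$ with $x\equiv_a c_1'$,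 $c_1\equiv_b c_2$, $c_2'\equiv_a c_3'$, $\dots$, $c_{2s-2}'\equiv_a c_{2s-1}'$, $c_{2s-1}\equiv_b y'$. With this product $\mathcal{CS}_X$ is a semigroup, and $\mathcal{IP}_X$ is the subsemigroup (an inverse semigroup) of all $a\in\mathcal{CS}_X$ each of whose blocks meets both $X$ and $X'$. For $X=\{1,\dots,n\}$ write $\mathcal{IP}_n$. $\mathcal{IS}_Y$ is the symmetric inverse semigroup of all bijections between subsets of $Y$ under composition of partial maps (left to right), and $\mathcal{IS}_m=\mathcal{IS}_{\{1,\dots,m\}}$. A representation of an inverse semigroup $S$ is a homomorphism $\phi:S\to\mathcal{IS}_Y$ for a (nonempty) set $Y$. It is faithful if injective; effective if every $y\in Y$ lies in the domain of $\phi(s)$ for some $s\in S$; transitive if for all $y,z\in Y$ there is $s\in S$ such that $\phi(s)$ is defined at $y$ and maps $y$ to $z$. Two representations $\phi:S\to\mathcal{IS}_Y$ and $\psi:S\to\mathcal{IS}_Z$ are equivalent if there is a bijection $\theta:Y\to Z$ such that, for all $s\in S$, $\psi(s)=\{(\theta(y_1),\theta(y_2)):(y_1,y_2)\in\phi(s)\}$ (partial maps regarded as sets of pairs). *)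

(* Defs.v *)
From HB Require Import structures.
From mathcomp Require Import all_boot.
From mathcomp Require Import boolp.

Set Implicit Arguments.
Unset Strict Implicit.
Unset Printing Implicit Defensive.

(* The disjoint union of X and its copy X' is the sum type X + X: inl x is    *)
(* the point x of X and inr x is the point x' of X'.                          *)
Section CS.
Variable X : finType.

Record CS := MkCS {
  cs_blocks :> {set {set X + X}};
  cs_partition : partition cs_blocks [set: X + X] }.

HB.instance Definition _ := [isSub for cs_blocks].
HB.instance Definition _ := [Choice of CS by <:].

Definition same_block (a : CS) : rel (X + X) :=
  fun u v => v \in pblock a u.

(* Chains are functions c : nat -> X, of which only the values c 1, c 2, ...  *)
(* up to c 2s (or c (2s - 1) between a point of X and a point of X') matter.  *)
Definition cs_mul_rel (a b : CS) (u v : X + X) : Prop :=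
  match u, v with
  | inl x, inl y =>
      same_block a (inl x) (inl y) \/
      exists (s : nat) (c : nat -> X),
        [/\ 0 < s,
            same_block a (inl x) (inr (c 1)),
            forall i, i < s ->
              same_block b (inl (c i.*2.+1)) (inl (c i.*2.+2)),
            forall i, i.+1 < s ->
              same_block a (inr (c i.*2.+2)) (inr (c i.*2.+3))
          & same_block a (inr (c s.*2)) (inl y)]
  | inr x, inr y =>
      same_block b (inr x) (inr y) \/
      exists (s : nat) (c : nat -> X),
        [/\ 0 < s,
            same_block b (inr x) (inl (c 1)),
            forall i, i < s ->
              same_block a (inr (c i.*2.+1)) (inr (c i.*2.+2)),
            forall i, i.+1 < s ->
              same_block b (inl (c i.*2.+2)) (inl (c i.*2.+3))
          & same_block b (inl (c s.*2)) (inr y)]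
  | inl x, inr y | inr y, inl x =>
      exists (s : nat) (c : nat -> X),
        [/\ 0 < s,
            same_block a (inl x) (inr (c 1)),
            forall i, i.+1 < s ->
              same_block b (inl (c i.*2.+1)) (inl (c i.*2.+2)),
            forall i, i.+1 < s ->
              same_block a (inr (c i.*2.+2)) (inr (c i.*2.+3))
          & same_block b (inl (c s.*2.-1)) (inr y)]
  end.

Lemma pblockT (a : CS) u : u \in cover a.
Proof. by rewrite (cover_partition (cs_partition a)) inE. Qed.

Lemma same_blockP (a : CS) u v :
  reflect (exists2 B, B \in cs_blocks a & (u \in B) && (v \in B))
          (same_block a u v).
Proof.
have tI := partition_trivIset (cs_partition a).
apply: (iffP idP) => [uv|[B aB /andP[uB vB]]]; last first.
  by rewrite /same_block (def_pblock tI aB uB).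
exists (pblock a u); first exact: pblock_mem (pblockT a u).
by rewrite mem_pblock pblockT.
Qed.

Lemma same_block_refl a : reflexive (same_block a).
Proof. by move=> u; rewrite /same_block mem_pblock pblockT. Qed.

Lemma same_block_eqE a u v : same_block a u v = (pblock a u == pblock a v).
Proof.
by rewrite eq_pblock ?pblockT //; exact: partition_trivIset (cs_partition a).
Qed.

Lemma same_block_sym a : symmetric (same_block a).
Proof. by move=> u v; rewrite !same_block_eqE eq_sym. Qed.

Lemma same_block_trans a : transitive (same_block a).
Proof. by move=> u v w; rewrite !same_block_eqE => /eqP-> /eqP->. Qed.

Lemma cs_ext (a b : CS) : same_block a =2 same_block b -> a = b.
Proof.
move=> eqab; apply: val_inj => /=.
rewrite -(equivalence_partition_pblock (cs_partition a)).
rewrite -(equivalence_partition_pblock (cs_partition b)).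
apply: eq_in_imset => u _; apply/setP => v; rewrite !inE; exact: eqab.
Qed.

Section Product.
Variables a b : CS.

(* Points c, d of the middle copy of X are adjacent when b relates them as    *)
(* upper points or a relates them as lower points; u is attached to c when    *)
(* u and c lie in one block of the factor that contains u.                    *)
Definition mid : rel X := fun c d =>
  same_block b (inl c) (inl d) || same_block a (inr c) (inr d).

Definition att (u : X + X) (c : X) : bool :=
  match u with
  | inl _ => same_block a u (inr c)
  | inr _ => same_block b u (inl c)
  end.

Definition outer (u v : X + X) : bool :=
  match u, v with
  | inl _, inl _ => same_block a u v
  | inr _, inr _ => same_block b u v
  | _, _ => false
  end.

Lemma connect_mid_sym : connect_sym mid.
Proof.
apply: sym_connect_sym => c d.
by rewrite /mid (same_block_sym b) (same_block_sym a).
Qed.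

Lemma att_mid u c d : att u c -> att u d -> mid c d.
Proof.
case: u => x /= uc ud; rewrite /mid.
  by rewrite [X in _ || X](@same_block_trans a (inl x)) ?orbT // same_block_sym.
by rewrite (@same_block_trans b (inr x)) // same_block_sym.
Qed.

Lemma outer_att u v c : outer u v -> att v c -> att u c.
Proof. by case: u v => x [] y //=; apply: same_block_trans. Qed.

Lemma outer_sym : symmetric outer.
Proof. by case=> x [] y //=; rewrite same_block_sym. Qed.

Definition joined (u v : X + X) : Prop :=
  outer u v \/ exists c d, [/\ att u c, connect mid c d & att v d].

Lemma joined_refl u : joined u u.
Proof. by left; case: u => x /=; exact: same_block_refl. Qed.

Lemma joined_sym u v : joined u v -> joined v u.
Proof.
case=> [uv|[c [d [uc cd vd]]]]; first by left; rewrite outer_sym.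
by right; exists d, c; rewrite connect_mid_sym.
Qed.

Lemma joined_trans u v w : joined u v -> joined v w -> joined u w.
Proof.
case=> [uv|[c [d [uc cd vd]]]] [vw|[c' [d' [vc' cd' wd']]]].
- left; case: u v w uv vw => x [] y [] z //=; exact: same_block_trans.
- by right; exists c', d'; rewrite (outer_att uv vc').
- by right; exists c, d; rewrite (@outer_att w v) // outer_sym.
right; exists c, d'; split=> //.
apply: connect_trans cd (connect_trans _ cd').
exact/connect1/(att_mid vd vc').
Qed.

End Product.

Lemma connect_chain (p q : rel X) (c d : X) :
  reflexive p -> reflexive q -> connect (fun c d => p c d || q c d) c d ->
  exists (s : nat) (f : nat -> X),
    [/\ 0 < s, f 1 = c, f s.*2 = d,
        forall i, i < s -> p (f i.*2.+1) (f i.*2.+2)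
      & forall i, i.+1 < s -> q (f i.*2.+2) (f i.*2.+3)].
Proof.
move=> pr qr /connectP[l pl ->] {d}.
elim: l c pl => [|e l IH] c /= => [_|/andP[ce /IH[s [f [s0 f1 fs fp fq]]]]].
  by exists 1, (fun=> c); split.
exists s.+1, (fun k => match k with
  | 0 | 1 => c
  | 2 => if p c e then e else c
  | k.+3 => f k.+1 end).
split=> //.
- by case: s s0 fs {fp fq} => // s _.
- case=> [_|i] /=; first by case: ifP.
  by rewrite ltnS => /fp.
case=> [_|i] /=; last by rewrite ltnS => /fq.
by rewrite f1; case: ifP ce => [_ _|_ /=].
Qed.

Lemma chain_connect (p q : rel X) (s : nat) (f : nat -> X) :
    0 < s ->
    (forall i, i < s -> p (f i.*2.+1) (f i.*2.+2)) ->
    (forall i, i.+1 < s -> q (f i.*2.+2) (f i.*2.+3)) ->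
  connect (fun c d => p c d || q c d) (f 1) (f s.*2).
Proof.
case: s => // s _; elim: s => [|s IH] fp fq.
  by apply: connect1; rewrite (fp 0).
apply: connect_trans (IH _ _) _ => [i /ltnW|i /ltnW|]; [exact: fp|exact: fq|].
apply: (@connect_trans _ _ (f s.+1.*2.+1)); apply: connect1.
  by rewrite (fq s) ?orbT.
by rewrite (fp s.+1).
Qed.

Lemma cs_mul_relP a b u v : cs_mul_rel a b u v <-> joined a b u v.
Proof.
have rl (e : CS) : reflexive (fun c d => same_block e (inl c) (inl d)).
  by move=> c; exact: same_block_refl.
have rr (e : CS) : reflexive (fun c d => same_block e (inr c) (inr d)).
  by move=> c; exact: same_block_refl.
have lr x y : cs_mul_rel a b (inl x) (inr y) <-> joined a b (inl x) (inr y).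
  split=> [[s [c [s0 xc cb ca cy]]]|[//|[c [d [/= xc cd yd]]]]].
    case: s s0 cb ca cy => // s _ cb ca cy.
    right; exists (c 1), (c s.*2.+1).
    split=> //; last by rewrite /= same_block_sym.
    case: s cb ca {cy} => [|s] cb ca; first exact: connect0.
    apply: connect_trans (chain_connect (ltn0Sn s) cb _) _ => [i /ltnW|].
      exact: ca.
    by apply: connect1; rewrite /mid ca ?orbT.
  have [s [f [s0 f1 fs fb fa]]] := connect_chain (rl b) (rr a) cd.
  exists s, f; split=> //; first by rewrite f1.
    by move=> i /ltnW; exact: fb.
  case: s s0 fs fb {fa} => // s _ fs /(_ s (leqnn _)) fb.
  apply: same_block_trans fb _.
  by rewrite -doubleS fs same_block_sym.
case: u v => x [] y.
- split=> [[xy|[s [c [s0 xc cb ca cy]]]]|[xy|[c [d [/= xc cd yd]]]]].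
  + by left.
  + right; exists (c 1), (c s.*2).
    split=> //; last by rewrite /= same_block_sym.
    exact: chain_connect.
  + by left.
  have [s [f [s0 f1 fs fb fa]]] := connect_chain (rl b) (rr a) cd.
  by right; exists s, f; split=> //; rewrite ?f1 ?fs // same_block_sym.
- exact: lr.
- by split=> [/lr|] /joined_sym // /lr.
have swap c d : connect (mid a b) c d =
    connect (fun c d => same_block a (inr c) (inr d)
                     || same_block b (inl c) (inl d)) c d.
  by apply: eq_connect => c' d'; rewrite /mid orbC.
split=> [[xy|[s [c [s0 xc cb ca cy]]]]|[xy|[c [d [/= xc cd yd]]]]].
- by left.
- right; exists (c 1), (c s.*2); split=> //; last by rewrite /= same_block_sym.
  by rewrite swap; exact: chain_connect.
- by left.
rewrite swap in cd.
have [s [f [s0 f1 fs fb fa]]] := connect_chain (rr a) (rl b) cd.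
by right; exists s, f; split=> //; rewrite ?f1 ?fs // same_block_sym.
Qed.

Definition cs_mulb (a b : CS) : rel (X + X) :=
  fun u v => `[< cs_mul_rel a b u v >].

Lemma cs_mulbP a b u v : reflect (joined a b u v) (cs_mulb a b u v).
Proof. by apply: (iffP (asboolP _)) => /cs_mul_relP. Qed.

Lemma cs_mulb_equiv a b : {in [set: X + X] & &, equivalence_rel (cs_mulb a b)}.
Proof.
move=> u v w _ _ _; split=> [|/cs_mulbP uv]; first exact/cs_mulbP/joined_refl.
apply/cs_mulbP/cs_mulbP; last exact: joined_trans.
exact/joined_trans/joined_sym.
Qed.

Definition cs_mul (a b : CS) : CS :=
  MkCS (equivalence_partitionP (@cs_mulb_equiv a b)).

Lemma same_block_mul a b u v :
  same_block (cs_mul a b) u v <-> cs_mul_rel a b u v.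
Proof.
rewrite /same_block pblock_equivalence_partition ?inE //; first last.
  exact: cs_mulb_equiv.
by split=> /asboolP.
Qed.

(* saturated a f g says that the union of f and of the copy of g in X' is a   *)
(* union of blocks of a.  As a relation between f and g it determines a and   *)
(* sends products to compositions of relations, whence associativity.         *)
Definition upto (f g : X -> Prop) (u : X + X) : Prop :=
  match u with inl x => f x | inr x => g x end.

Definition saturated (a : CS) (f g : X -> Prop) : Prop :=
  forall u v, same_block a u v -> upto f g u -> upto f g v.

Lemma saturated_inj a b :
  (forall f g, saturated a f g <-> saturated b f g) -> a = b.
Proof.
suff H (c d : CS) : (forall f g, saturated c f g -> saturated d f g) ->
    forall u v, same_block d u v -> same_block c u v.
  move=> ab; apply: cs_ext => u v; apply/idP/idP; apply: H => f g /ab //.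
move=> cd u v duv.
have E w : upto (fun x => same_block c u (inl x))
    (fun x => same_block c u (inr x)) w = same_block c u w by case: w.
rewrite -E; apply: (cd _ _ _ u v duv); last by rewrite E same_block_refl.
move=> w w' ww'; rewrite !E => uw; exact: same_block_trans ww'.
Qed.

Lemma saturated_mul a b f h :
  saturated (cs_mul a b) f h <-> exists g, saturated a f g /\ saturated b g h.
Proof.
have Jn u v : same_block (cs_mul a b) u v <-> joined a b u v.
  by rewrite same_block_mul cs_mul_relP.
split=> [sat|[g [sa sb]] u v /Jn uv].
  have satJ u v : joined a b u v -> upto f h u -> upto f h v by move=> /Jn /sat.
  pose g c := exists u d, [/\ upto f h u, att a b u d & connect (mid a b) d c].
  have g_mid c d : g c -> mid a b c d -> g d.
    move=> [u [e [fu ue ec]]] cd; exists u, e; split=> //.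
    exact: connect_trans (connect1 cd).
  have g_att u c : g c -> att a b u c -> upto f h u.
    move=> [v [d [fv vd dc]]] uc; apply: satJ fv; right.
    by exists d, c.
  have att_g u c : upto f h u -> att a b u c -> g c.
    by move=> fu uc; exists u, c.
  exists g; split=> -[] x [] y xy /=.
  - by apply: (satJ (inl x) (inl y)); left.
  - by move=> fx; exact: (att_g (inl x)).
  - by move=> gx; apply: (g_att (inl y) x gx); rewrite /= same_block_sym.
  - by move=> gx; apply: g_mid gx _; rewrite /mid xy orbT.
  - by move=> gx; apply: g_mid gx _; rewrite /mid xy.
  - by move=> gx; apply: (g_att (inr y) x gx); rewrite /= same_block_sym.
  - by move=> fx; exact: (att_g (inr x)).
  - by apply: (satJ (inr x) (inr y)); left.
have att_g w c : upto f h w -> att a b w c -> g c.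
  by case: w => x fx xc; [exact: sa xc fx | exact: sb xc fx].
have g_att w c : g c -> att a b w c -> upto f h w.
  case: w => x gc; rewrite /= same_block_sym => xc; first exact: sa xc gc.
  exact: sb xc gc.
case: uv => [|[c [d [uc /connectP[p cp dE] vd]]] fu].
  by case: u v => x [] y //= xy; [exact: sa xy | exact: sb xy].
apply: (g_att v d) vd; have {fu uc} := att_g u c fu uc.
elim: p c cp dE => [c _ ->//|e p IH c /= /andP[ce ep] dE gc].
apply: (IH e ep dE); by case/orP: ce => [/sb|/sa]; apply.
Qed.

Lemma cs_mulA : associative cs_mul.
Proof.
move=> a b c; apply: saturated_inj => f h; rewrite !saturated_mul; split.
- move=> [g [ag /saturated_mul[k [bk ch]]]]; exists k; split=> //.
  by apply/saturated_mul; exists g.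
move=> [g [/saturated_mul[k [ak bg]] ch]]; exists k; split=> //.
by apply/saturated_mul; exists g.
Qed.

HB.instance Definition _ := isSemigroup.Build CS cs_mulA.

Definition spanning (a : CS) : bool :=
  [forall B in cs_blocks a,
     [exists x, inl x \in B] && [exists x, inr x \in B]].

Lemma spanningP (a : CS) :
  reflect (forall u, (exists x, same_block a u (inl x)) /\
                     (exists x, same_block a u (inr x))) (spanning a).
Proof.
apply: (iffP forall_inP) => [sp u|sp B aB].
  have /andP[/existsP[x ux] /existsP[y uy]] := sp _ (pblock_mem (pblockT a u)).
  by split; [exists x | exists y].
have tI := partition_trivIset (cs_partition a).
have /set0Pn[u uB] := partition_neq0 (cs_partition a) aB.
have [[x ux] [y uy]] := sp u.
rewrite /same_block (def_pblock tI aB uB) in ux uy.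
by apply/andP; split; apply/existsP; [exists x | exists y].
Qed.

Lemma spanning_mul : mulg_closed spanning.
Proof.
move=> a b /spanningP sa /spanningP sb; apply/spanningP.
have J u v : joined a b u v -> same_block (a * b)%g u v.
  by move=> uv; apply/same_block_mul/cs_mul_relP.
have dn x c y : same_block a (inl x) (inr c) -> same_block b (inl c) (inr y) ->
    same_block (a * b)%g (inl x) (inr y).
  move=> xc cy; apply: J; right; exists c, c.
  by rewrite /= same_block_sym in cy *; rewrite xc cy.
case=> x; split.
- by exists x; exact: same_block_refl.
- have [_ [c xc]] := sa (inl x); have [_ [y cy]] := sb (inl c).
  by exists y; exact: dn cy.
- have [[c xc] _] := sb (inr x); have [[y cy] _] := sa (inr c).
  exists y; rewrite same_block_sym; rewrite same_block_sym in cy.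
  by apply: dn cy _; rewrite same_block_sym.
- by exists x; exact: same_block_refl.
Qed.

Record IP := MkIP { ip_val :> CS; ip_spanning : spanning ip_val }.

HB.instance Definition _ := [isSub for ip_val].
HB.instance Definition _ := [Choice of IP by <:].
HB.instance Definition _ :=
  SubChoice_isSubSemigroup.Build CS spanning IP spanning_mul.

End CS.

(* A bijection between two subsets of Y is an injective partial map from Y to *)
(* itself; None means undefined.                                              *)
Record IS (Y : Type) := MkIS {
  isym_fun :> Y -> option Y;
  isym_inj : forall y1 y2 z,
    isym_fun y1 = Some z -> isym_fun y2 = Some z -> y1 = y2 }.

Section IS.
Variable Y : Type.

HB.instance Definition _ := gen_eqMixin (IS Y).
HB.instance Definition _ := gen_choiceMixin (IS Y).

Lemma isym_ext (f g : IS Y) : f =1 g -> f = g.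
Proof.
case: f g => f fi [g gi] /= /funext fg.
by case: g / fg gi => gi; rewrite (Prop_irrelevance fi gi).
Qed.

Lemma isym_mul_inj (f g : IS Y) y1 y2 z :
  obind g (f y1) = Some z -> obind g (f y2) = Some z -> y1 = y2.
Proof.
case e1: (f y1) => [w1|//] /= g1; case e2: (f y2) => [w2|//] /= g2.
by apply: isym_inj e1 _; rewrite (isym_inj g1 g2).
Qed.

(* Composition from left to right: f first, then g. *)
Definition isym_mul (f g : IS Y) : IS Y := MkIS (@isym_mul_inj f g).

Lemma isym_mulA : associative isym_mul.
Proof. by move=> f g h; apply: isym_ext => y /=; case: (f y). Qed.

HB.instance Definition _ := isSemigroup.Build (IS Y) isym_mulA.

End IS.

(* A representation of S is a multiplicative map phi : S -> IS Y where Y is   *)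
(* nonempty; multiplicativity is carried by the type of phi.                  *)
Section Representations.
Variable S : semigroupType.

Definition faithful_rep (Y : Type) (phi : {multiplicative S -> IS Y}) : Prop :=
  injective phi.

Definition effective_rep (Y : Type) (phi : {multiplicative S -> IS Y}) : Prop :=
  forall y, exists s z, phi s y = Some z.

Definition transitive_rep (Y : Type)
    (phi : {multiplicative S -> IS Y}) : Prop :=
  forall y z, exists s, phi s y = Some z.

Definition fet_rep (Y : Type) (phi : {multiplicative S -> IS Y}) : Prop :=
  [/\ inhabited Y, faithful_rep phi, effective_rep phi & transitive_rep phi].

Definition equivalent_rep (Y Z : Type) (phi : {multiplicative S -> IS Y})
    (psi : {multiplicative S -> IS Z}) : Prop :=
  exists2 theta : Y -> Z, bijective theta &
    forall s z1 z2, psi s z1 = Some z2 <->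
      exists y1 y2, [/\ phi s y1 = Some y2, z1 = theta y1 & z2 = theta y2].

End Representations.

(* Main.v *)
(* IP_X acts on the nonempty proper subsets of X: a maps A to B when A together
   with B' is a union of blocks of a, and this action determines a.

   Conversely let psi be a faithful transitive representation.  The one-block
   partition 0 acts nowhere, for otherwise psi would be trivial.  Let t(P, Q) be
   the partition with the two blocks P u Q' and ~P u ~Q'.  Faithfulness gives,
   for a fixed P, a point y0 fixed by t(P, P) but not by the swap t(P, ~P).
   Since t(P, Q) s is t(P, R) if s maps Q to R and is 0 if s is undefined at Q,
   sending Q to the image of y0 under t(P, Q) is the required equivalence. *)
Require Import Defs.
From HB Require Import structures.
From mathcomp Require Import all_boot.
From mathcomp Require Import boolp.

Set Implicit Arguments.
Unset Strict Implicit.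
Unset Printing Implicit Defensive.

(** * Pairs of subsets that form unions of blocks *)

Section Saturation.
Variable X : finType.
Implicit Types (A B C D E : {set X}) (a b : CS X).

Definition side A B (u : X + X) : bool :=
  match u with inl x => x \in A | inr x => x \in B end.

(** Requiring equality rather than an implication, which is equivalent because [same_block] is
    symmetric, makes closure under complements immediate. *)
Definition sat a A B : Prop :=
  forall u v, same_block a u v -> side A B u = side A B v.

Lemma mem_asbool (f : X -> Prop) :
  (fun x => is_true (x \in [set x | `[< f x >]])) = f.
Proof. by apply/funext => x; apply/propext; rewrite inE; split=> /asboolP. Qed.

Lemma satE a A B :
  sat a A B <-> saturated a (fun x => x \in A) (fun x => x \in B).
Proof.
have E w : upto (fun x => x \in A) (fun x => x \in B) w = side A B w by case: w.
split=> s u v uv; first by rewrite !E (s _ _ uv).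
apply/idP/idP; rewrite -!E; apply: s => //; by rewrite same_block_sym.
Qed.

Lemma sat_mul a b A C :
  sat (a * b)%g A C <-> exists2 B, sat a A B & sat b B C.
Proof.
rewrite satE saturated_mul; split=> [[g [ag gb]]|[B /satE aB /satE Bb]].
  by exists [set x | `[< g x >]]; apply/satE; rewrite mem_asbool.
by exists (fun x => x \in B).
Qed.

Lemma sat_ext a b : (forall A B, sat a A B <-> sat b A B) -> a = b.
Proof.
move=> ab; apply: saturated_inj => f g.
by rewrite -(mem_asbool f) -(mem_asbool g) -!satE.
Qed.

Lemma sat_setC a A B : sat a A B -> sat a (~: A) (~: B).
Proof.
move=> s u v /s; have E w : side (~: A) (~: B) w = ~~ side A B w.
  by case: w => x; rewrite /= inE.
by rewrite !E => ->.
Qed.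

Lemma sat_set0 a : sat a set0 set0.
Proof. by move=> [] x [] y; rewrite /= !inE. Qed.

Lemma sat_setT a : sat a setT setT.
Proof. by move=> [] x [] y; rewrite /= !inE. Qed.

Arguments sat_set0 : clear implicits.
Arguments sat_setT : clear implicits.

(** The block of a point of X' also meets X, so [A] decides whether that point belongs to the
    right-hand set. *)
Lemma sat_funr (a : IP X) A B C : sat a A B -> sat a A C -> B = C.
Proof.
move=> sB sC; apply/setP=> x.
have [[y xy] _] := spanningP _ (ip_spanning a) (inr x).
by have /= -> := sB _ _ xy; have /= -> := sC _ _ xy.
Qed.

Lemma sat_funl (a : IP X) A B C : sat a A C -> sat a B C -> A = B.
Proof.
move=> sA sB; apply/setP=> x.
have [_ [y xy]] := spanningP _ (ip_spanning a) (inl x).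
by have /= -> := sA _ _ xy; have /= -> := sB _ _ xy.
Qed.

(** * Nonempty proper subsets *)

Definition nontriv A : bool := (A != set0) && (A != setT).

Lemma nontrivP A :
  reflect ((exists x, x \in A) /\ (exists x, x \notin A)) (nontriv A).
Proof.
apply: (iffP andP) => [[/set0Pn A0 AT]|[A0 [x xA]]]; split=> //.
- by have /subsetPn[x _ xA] : ~~ ([set: X] \subset A); [rewrite subTset | exists x].
- exact/set0Pn.
- by apply: contraNneq xA => ->; rewrite inE.
Qed.

Lemma nontrivC A : nontriv (~: A) = nontriv A.
Proof.
rewrite /nontriv andbC -(inj_eq (@setC_inj X) A set0) setC0.
by rewrite -(inj_eq (@setC_inj X) A setT) setCT.
Qed.

Lemma sat_nontriv (a : IP X) A B : sat a A B -> nontriv B = nontriv A.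
Proof.
move=> s; congr (~~ _ && ~~ _); apply/eqP/eqP=> e; subst.
- exact: sat_funl s (sat_set0 a).
- exact: sat_funr s (sat_set0 a).
- exact: sat_funl s (sat_setT a).
- exact: sat_funr s (sat_setT a).
Qed.

Lemma sat_triv (a : IP X) A B : ~~ nontriv A -> sat a A B <-> A = B.
Proof.
rewrite negb_and !negbK => /orP[] /eqP->; split=> [s|<-];
  [exact: sat_funr (sat_set0 a) s | exact: sat_set0
  |exact: sat_funr (sat_setT a) s | exact: sat_setT].
Qed.

(** By [sat_triv] all elements act alike on the empty and the full set, so only the other subsets
    can tell them apart. *)
Lemma ip_ext (a b : IP X) :
  (forall A B, nontriv A -> sat a A B <-> sat b A B) -> a = b.
Proof.
move=> ab; apply: val_inj; apply: sat_ext => A B /=.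
by have [/ab//|/sat_triv nA] := boolP (nontriv A); rewrite !nA.
Qed.

(** * Partitions with one or two blocks, and their products *)

Lemma side_equiv A B :
  {in [set: X + X] & &, equivalence_rel (fun u v => side A B u == side A B v)}.
Proof. by move=> u v w _ _ _; split=> [|/eqP->]. Qed.

(* With A = B = set0 this is the one-block partition. *)
Definition two_blocks A B : CS X :=
  MkCS (equivalence_partitionP (@side_equiv A B)).

Lemma same_two_blocks A B u v :
  same_block (two_blocks A B) u v = (side A B u == side A B v).
Proof.
rewrite /same_block pblock_equivalence_partition ?inE //.
exact: side_equiv.
Qed.

Lemma spanning_one_block : spanning (two_blocks set0 set0).
Proof.
apply/spanningP=> u; case: (u) => x;
  by split; exists x; rewrite same_two_blocks /= !inE.
Qed.

Definition ip_zero : IP X := MkIP spanning_one_block.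

Lemma sat_zero A B : nontriv A -> ~ sat ip_zero A B.
Proof.
move=> /nontrivP[[x xA] [y /negP yA]] s; apply: yA.
by have /= <- := s (inl x) (inl y); rewrite // same_two_blocks /= !inE.
Qed.

Lemma spanning_two_blocks A B :
  nontriv A -> nontriv B -> spanning (two_blocks A B).
Proof.
move=> /nontrivP[[x xA] [y yA]] /nontrivP[[z zB] [t tB]]; apply/spanningP=> u.
case: (boolP (side A B u)) => uE.
  split; [exists x | exists z];
  by rewrite same_two_blocks uE /= ?xA ?zB.
split; [exists y | exists t];
by rewrite same_two_blocks (negPf uE) /= ?(negPf yA) ?(negPf tB).
Qed.

Lemma sat_two_blocks A B C D : nontriv A -> nontriv C ->
  sat (two_blocks A B) C D <-> (C = A /\ D = B) \/ (C = ~: A /\ D = ~: B).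
Proof.
move=> /nontrivP[[x xA] [y yA]] nC.
have sAB : sat (two_blocks A B) A B by move=> u v; rewrite same_two_blocks=> /eqP.
split=> [s|[[-> ->]//|[-> ->]]]; last exact: sat_setC.
(* The points [x] and [y] represent the two blocks, so whether they lie in [C] determines both [C]
   and [D]. *)
have sE u : side C D u = if side A B u then x \in C else y \in C.
  case: ifP => uE; [apply: (s u (inl x)) | apply: (s u (inl y))];
  by rewrite same_two_blocks uE /= ?xA ?(negPf yA).
have lE z : z \in C = if z \in A then x \in C else y \in C := sE (inl z).
have rE z : z \in D = if z \in B then x \in C else y \in C := sE (inr z).
move/nontrivP: nC => [[z zC] [t tC]].
case xC: (x \in C) lE rE zC tC; case yC: (y \in C) => lE rE zC tC.
- by rewrite lE if_same in tC.
- by left; split; apply/setP=> w; rewrite ?lE ?rE; case: ifP.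
- by right; split; apply/setP=> w; rewrite inE ?lE ?rE; case: ifP.
- by rewrite lE if_same in zC.
Qed.

Definition pset := {A : {set X} | nontriv A}.

Lemma card_pset : 2 <= #|X| -> #|{: pset}| = 2 ^ #|X| - 2.
Proof.
move=> X2; rewrite card_sig.
have -> : #|[pred A | nontriv A]| = #|~: [set set0; [set: X]]|.
  by apply: eq_card => A; rewrite !inE negb_or.
rewrite cardsCs setCK cards2 -cardsT -powersetT card_powerset cardsT.
suff -> : set0 != [set: X] by [].
by rewrite eq_sym -card_gt0 cardsT ltnW.
Qed.

Definition ip_two (P Q : pset) : IP X :=
  MkIP (spanning_two_blocks (valP P) (valP Q)).

(** On nonempty proper subsets [ip_two P Q] only sends P to Q and ~P to ~Q; [s] carries Q to R,
    hence ~Q to ~R. *)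
Lemma ip_two_mul (P Q R : pset) (s : IP X) : sat s (val Q) (val R) ->
  (ip_two P Q * s)%g = ip_two P R.
Proof.
move=> sQR; apply: ip_ext => C D nC.
rewrite sat_mul (sat_two_blocks _ _ (valP P) nC); split=> [[E]|].
  rewrite (sat_two_blocks _ _ (valP P) nC) => -[[-> ->]|[-> ->]] sE.
    by left; rewrite (sat_funr sE sQR).
  by right; rewrite (sat_funr sE (sat_setC sQR)).
move=> [[-> ->]|[-> ->]]; [exists (val Q) | exists (~: val Q)] => //;
  try by apply/sat_two_blocks; rewrite ?nontrivC ?(valP P); auto.
exact: sat_setC.
Qed.

(** If [s] is undefined at Q, then by complementation it is undefined at ~Q, the only other possible
    intermediate set. *)
Lemma ip_two_mul0 (P Q : pset) (s : IP X) :
  (forall R : pset, ~ sat s (val Q) (val R)) ->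
  (ip_two P Q * s)%g = ip_zero.
Proof.
move=> nQ; apply: ip_ext => C D nC; split=> [|/(sat_zero nC)//].
have {}nQ E : ~ sat s (val Q) E.
  move=> sE; have nE : nontriv E by rewrite (sat_nontriv sE) (valP Q).
  exact: (nQ (exist _ E nE)).
move=> /sat_mul[E /(sat_two_blocks _ _ (valP P) nC)[[_ ->]|[_ ->]]].
  by move/nQ.
by move/sat_setC; rewrite setCK => /nQ.
Qed.

Lemma ip_zero_mul (s : IP X) : (ip_zero * s)%g = ip_zero.
Proof.
apply: ip_ext => C D nC; split=> [|/(sat_zero nC)//].
by move=> /sat_mul[E /(sat_zero nC)].
Qed.

End Saturation.

Lemma isym_mulE (S : semigroupType) (Y : Type) (psi : {multiplicative S -> IS Y})
  (s t : S) y : psi (s * t)%g y = obind (psi t) (psi s y).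
Proof. by rewrite gmulfM. Qed.

(** * The action on nonempty proper subsets *)

Section SubsetRepresentation.
Variables (X I : finType) (e : I -> pset X).
Hypothesis e_bij : bijective e.
Implicit Types (s t : IP X) (i j : I).

(** Subsets are indexed through [e] so that the action can be placed on any finite set of the right
    size. *)
Definition moves s i j : Prop := sat s (val (e i)) (val (e j)).

Definition subset_fun s i : option I := [pick j | `[< moves s i j >]].

Lemma e_val_inj i j : val (e i) = val (e j) -> i = j.
Proof. by move/val_inj/(bij_inj e_bij). Qed.

Lemma subset_funP s i j : subset_fun s i = Some j <-> moves s i j.
Proof.
rewrite /subset_fun; case: pickP => [k /asboolP ik|n].
  by split=> [[<-]//|ij]; congr Some; apply/e_val_inj/(sat_funr ik ij).
by split=> // /asboolP; rewrite n.
Qed.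

Lemma subset_fun_inj s i j k :
  subset_fun s i = Some k -> subset_fun s j = Some k -> i = j.
Proof. by move=> /subset_funP ik /subset_funP jk; apply/e_val_inj/(sat_funl ik jk). Qed.

Definition subset_isym s : IS I := MkIS (@subset_fun_inj s).

Lemma sat_moves s i B : sat s (val (e i)) B -> exists2 j, moves s i j & val (e j) = B.
Proof.
move=> sB; have nB : nontriv B by rewrite (sat_nontriv sB) (valP (e i)).
have [f _ ef] := e_bij.
have E : val (e (f (exist _ B nB))) = B by rewrite ef.
by exists (f (exist _ B nB)); rewrite // /moves E.
Qed.

Lemma subset_isymM : {morph subset_isym : s t / (s * t)%g}.
Proof.
move=> s t; apply: isym_ext => i /=.
(* The intermediate set given by [sat_mul] is again nonempty and proper, hence of the form
   [val (e j)]. *)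
have M k : moves (s * t)%g i k <-> exists2 j, moves s i j & moves t j k.
  split=> [/sat_mul[B /sat_moves[j ij <-] jk]|[j ij jk]]; first by exists j.
  by apply/sat_mul; exists (val (e j)).
case E: (subset_fun s i) => [j|] /=.
  move/subset_funP: E => ij; case F: (subset_fun t j) => [k|].
    by apply/subset_funP/M; exists j => //; apply/subset_funP.
  case G: (subset_fun _ i) => [k|//].
  move/subset_funP/M: G => [j' ij' /subset_funP].
  by have /e_val_inj-> := sat_funr ij' ij; rewrite F.
case G: (subset_fun _ i) => [k|//].
by move/subset_funP/M: G => [j /subset_funP]; rewrite E.
Qed.

HB.instance Definition _ := isMultiplicative.Build _ _ subset_isym subset_isymM.

Definition subset_rep : {multiplicative IP X -> IS I} := subset_isym.

Lemma subset_rep_inj : injective subset_rep.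
Proof.
move=> s t st; apply: ip_ext => A B nA.
have [f _ ef] := e_bij.
have E : val (e (f (exist _ A nA))) = A by rewrite ef.
have st_moves i j : moves s i j <-> moves t i j.
  have st_fun : subset_fun s = subset_fun t := congr1 (@isym_fun I) st.
  by rewrite -!subset_funP st_fun.
by rewrite -E; split=> /sat_moves[j /st_moves ij <-].
Qed.

Lemma subset_rep_trans : transitive_rep subset_rep.
Proof.
move=> i j; exists (ip_two (e i) (e j)); apply/subset_funP/sat_two_blocks; last by left.
- exact: valP.
- exact: valP.
Qed.

Lemma subset_rep_fet : I -> fet_rep subset_rep.
Proof.
move=> i0; split=> //; [exact: subset_rep_inj| |exact: subset_rep_trans].
by move=> i; have [s si] := subset_rep_trans i i0; exists s, i0.
Qed.

(** * Uniqueness up to equivalence *)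

Section Uniqueness.
Variables (Y : Type) (psi : {multiplicative IP X -> IS Y}).
Hypothesis psi_fet : fet_rep psi.

(** If zero sent [y] to [z], then 0s = 0 would make every [s] fix [z]; by transitivity [Y] would be
    the single point [z] and [psi] constant, against faithfulness. *)
Lemma psi_zero (P : pset X) y : psi (ip_zero X) y = None.
Proof.
have [_ inj _ tr] := psi_fet.
case E: (psi (ip_zero X) y) => [z|//].
have fixz s : psi s z = Some z.
  by have := isym_mulE psi (ip_zero X) s y; rewrite ip_zero_mul E.
have Yz w : w = z by have [s] := tr z w; rewrite fixz => -[].
have /inj E0 : psi (ip_two P P) = psi (ip_zero X).
  by apply: isym_ext => w; rewrite (Yz w) !fixz.
have := sat_zero (B := val P) (valP P); rewrite -E0; case.
by apply/sat_two_blocks; rewrite ?(valP P); auto.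
Qed.

Definition pcompl (P : pset X) : pset X :=
  exist _ (~: val P) (etrans (nontrivC (val P)) (valP P)).

Lemma exists_base_point (P : pset X) :
  exists2 y, psi (ip_two P P) y = Some y & psi (ip_two P (pcompl P)) y <> Some y.
Proof.
have [_ inj _ _] := psi_fet.
set u := ip_two P P; set g := ip_two P (pcompl P).
have sP : sat u (val P) (val P) by apply/sat_two_blocks; rewrite ?(valP P); auto.
have uu : (u * u)%g = u by exact: ip_two_mul.
have ug : (u * g)%g = g.
  by apply: ip_two_mul; apply/sat_two_blocks; rewrite ?(valP P); auto.
(* An idempotent injective partial map is a partial identity. *)
have u_fix y z : psi u y = Some z -> psi u y = Some y.
  move=> yz; have := isym_mulE psi u u y; rewrite uu yz /= => /esym zz.
  by rewrite (isym_inj zz yz).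
apply: contrapT => H.
have u_le y : psi u y = Some y -> psi g y = Some y.
  by move=> uy; apply: contrapT => gy; apply: H; exists y.
(* Without a base point [psi g] fixes the whole domain of [psi u], and ug = g confines its own
   domain to that one. *)
have ug_eq : psi u = psi g.
  apply: isym_ext => y; have := isym_mulE psi u g y; rewrite ug.
  case E: (psi u y) => [z|] //= gE.
  by move: (E) gE; rewrite (u_fix _ _ E) => -[<-] ->; rewrite u_le // (u_fix _ _ E).
have sg : sat g (val P) (~: val P) by apply/sat_two_blocks; rewrite ?(valP P); auto.
have /nontrivP[[x xP] _] := valP P.
have PE : val P = ~: val P by apply: sat_funr sP _; rewrite (inj _ _ ug_eq).
by have := xP; rewrite [in X in X -> _]PE inE xP.
Qed.

Lemma subset_rep_unique : I -> equivalent_rep subset_rep psi.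
Proof.
move=> i0; pose P := e i0; have [_ _ _ tr] := psi_fet.
have [y0 uy gy] := exists_base_point P.
pose t i := ip_two P (e i).
(* The default [y0] is never reached: by [thetaE], [psi (t i)] is defined at [y0]. *)
pose theta i := odflt y0 (psi (t i) y0).
have satt i : sat (t i) (val P) (val (e i)).
  by apply/sat_two_blocks; rewrite ?(valP P); auto.
have thetaE i : psi (t i) y0 = Some (theta i).
  (* The product [ip_two P P] is defined at [y0], hence so is its first factor. *)
  have : (t i * ip_two (e i) P)%g = ip_two P P.
    by apply: ip_two_mul; apply/sat_two_blocks; rewrite ?(valP (e i)); auto.
  move/(congr1 (fun s => psi s y0)); rewrite uy isym_mulE /theta.
  by case: (psi (t i) y0).
have move_theta s i j : moves s i j -> psi s (theta i) = Some (theta j).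
  move=> ij; have := isym_mulE psi (t i) s y0.
  by rewrite thetaE /= => <-; rewrite (ip_two_mul _ ij) thetaE.
have theta_move s i z :
    psi s (theta i) = Some z -> exists2 j, moves s i j & z = theta j.
  move=> sz; have [[j ij]|nij] := pselect (exists j, moves s i j).
    by exists j => //; move: sz; rewrite (move_theta _ _ _ ij) => -[].
  (* If [s] were undefined at [e i], then [t i * s] would be zero, which acts nowhere, yet it sends
     [y0] to [z]. *)
  have := isym_mulE psi (t i) s y0; rewrite thetaE /= sz ip_two_mul0.
    by rewrite psi_zero.
  by move=> R sR; case: nij; have [j ij _] := sat_moves sR; exists j.
have theta_i0 : theta i0 = y0 by rewrite /theta uy.
have theta_inj : injective theta.
  move=> i j ij; have si : moves (ip_two (e i) P) i i0.
    by apply/sat_two_blocks; rewrite ?(valP (e i)); auto.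
  (* As [ip_two (e i) P] sends the common value to [y0], it moves [j] to some [k] with
     [theta k = y0]. Either [e j = e i], or [e k] is the complement of [P]; [gy] excludes the
     latter. *)
  have := move_theta _ _ _ si; rewrite theta_i0 ij => /theta_move[k + y0k].
  move/(sat_two_blocks _ _ (valP (e i)) (valP (e j))) => [[/e_val_inj-> //]|[_ kE]].
  case: gy; rewrite [RHS](congr1 Some y0k) -thetaE /t.
  by congr (psi (ip_two P _) y0); apply: val_inj.
have theta_surj y : exists i, theta i = y.
  have [s] := tr y0 y; rewrite -{1}theta_i0 => /theta_move[j _ ->].
  by exists j.
exists theta.
  have [f fK] := choice theta_surj.
  by exists f => // i; apply: theta_inj; rewrite fK.
move=> s z1 z2; split=> [|[i [j [/subset_funP ij -> ->]]]]; last exact: move_theta.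
have [i <-] := theta_surj z1; move=> /theta_move[j ij ->].
by exists i, j; split=> //; apply/subset_funP.
Qed.

End Uniqueness.
End SubsetRepresentation.

(** * Transfer to 2^n - 2 points *)

Theorem theorem8 (n : nat) (hn : 2 <= n) :
  (exists phi : {multiplicative IP 'I_n -> IS 'I_(2 ^ n - 2)},
     fet_rep phi /\
     forall (Y : Type) (psi : {multiplicative IP 'I_n -> IS Y}),
       fet_rep psi -> equivalent_rep phi psi)
  /\
  (exists phi : {multiplicative IP 'I_n -> IS 'I_(2 ^ n - 2)}, injective phi).
Proof.
have cardE : 2 ^ n - 2 = #|{: pset 'I_n}| by rewrite card_pset card_ord.
pose e (i : 'I_(2 ^ n - 2)) : pset 'I_n := enum_val (cast_ord cardE i).
have e_bij : bijective e.
  exists (fun P => cast_ord (esym cardE) (enum_rank P)) => [i|P].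
    by rewrite /e enum_valK cast_ordK.
  by rewrite /e cast_ordKV enum_rankK.
have i0 : 'I_(2 ^ n - 2).
  (* From n >= 2 follows 2 = 2^1 < 2^n. *)
  have lt0 : 0 < 2 ^ n - 2 by rewrite subn_gt0 -{1}(expn1 2) ltn_exp2l.
  exact: Ordinal lt0.
split; exists (subset_rep e_bij); last exact: subset_rep_inj.
split=> [|Y psi psi_fet]; first exact: subset_rep_fet i0.
exact: subset_rep_unique psi_fet i0.
Qed.
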